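(* Let $k\ge 1$ be a fixed integer, and for $n\ge k+1$ let $N=\binom{n}{k+1}$ and let $r=r(n)$ be an integer with $0\le r\le N$. Let $F$ and $G$ be independent, uniformly chosen subsets of size $r$ of the $N$-element set $C_{n,k}=\binom{[n]}{k+1}$. Then, as $n\to\infty$: \begin{itemize} \item if $r=o(\sqrt{N})$, then $\mathbb{P}(F\cap G\neq\emptyset)\to 0$; \item if $r=\omega(\sqrt{N})$, then $\mathbb{P}(F\cap G\neq\emptyset)\to 1$. \end{itemize}
   Context: $[n]=\{1,\dots,n\}$ and $\binom{[n]}{k+1}$ denotes the set of its $(k+1)$-element subsets (called circuits). $r=o(\sqrt N)$ means $r/\sqrt N\to 0$ and $r=\omega(\sqrt N)$ means $r/\sqrt N\to\infty$ as $n\to\infty$. *)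

(* Defs.v *)
From HB Require Import structures.
From mathcomp Require Import all_boot all_order all_algebra.
From mathcomp Require Import all_classical all_reals all_analysis.

Set Implicit Arguments.
Unset Strict Implicit.
Unset Printing Implicit Defensive.

Import Order.TTheory GRing.Theory Num.Theory.
Import numFieldNormedType.Exports.

(* The vertex set {1, ..., n} is represented by 'I_n = {0, ..., n - 1}. *)
Definition circuits (n k : nat) : {set {set 'I_n}} :=
  [set c : {set 'I_n} | #|c| == k.+1]%SET.

Definition circuit_sets (n k r : nat) : {set {set {set 'I_n}}} :=
  [set A : {set {set 'I_n}} | (A \subset circuits n k) && (#|A| == r)]%SET.

Local Open Scope classical_set_scope.
Local Open Scope ring_scope.

Section RandomElements.
Context (d : measure_display) (T : measurableType d) (R : realType).
Context (P : probability T R) (S : finType).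

(* Measurability with respect to the discrete sigma-algebra on S. *)
Definition random_element (X : T -> S) : Prop :=
  forall B : set S, measurable (X @^-1` B).

Definition uniform_on (E : {set S}) (X : T -> S) : Prop :=
  forall s : S,
    P (X @^-1` [set s]) = (if s \in E then (#|E|%:R)^-1 else 0)%:E.

Definition independent (X Y : T -> S) : Prop :=
  forall B C : set S,
    P (X @^-1` B `&` Y @^-1` C) = (P (X @^-1` B) * P (Y @^-1` C))%E.

End RandomElements.

(* Main.v *)
Require Import Defs.
From mathcomp Require Import all_boot all_order all_algebra.
From mathcomp Require Import all_classical all_reals all_analysis.
From mathcomp Require Import zify lra.

Set Implicit Arguments.
Unset Strict Implicit.
Unset Printing Implicit Defensive.

Import Order.TTheory GRing.Theory Num.Theory.
Import numFieldNormedType.Exports.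

Local Open Scope classical_set_scope.
Local Open Scope ring_scope.

(** Write N for the number of circuits.  Given F, the r circuits of G avoid F
with probability C(N - r, r) / C(N, r), whatever the value of F, so this ratio
is the probability p that F and G are disjoint ([pr_disjoint]).  Everything
depends on x = r^2 / N, the expected number of common circuits:

    1 - x <= p <= 1 / (1 + x).

The first inequality is a union bound; the second replaces the familiar
estimate p <= exp (- x) by a rational one, which still tends to 0 as x tends to
infinity.  Both are inequalities between binomial coefficients, proved by
induction on the number of circuits drawn for G, with no asymptotics
([bin_sub_lower], [bin_sub_upper]).

Hence 1 - 1 / (1 + x) <= P (F meets G) <= x ([pr_meet_bounds]).  Since
x = (r / sqrt N)^2, it tends to 0 when r = o(sqrt N) and to infinity when
r = omega(sqrt N), and both limits follow by squeezing. *)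

(** * Ratios of binomial coefficients *)

(** This is 1 - m r / N <= p for p = C(N - m, r) / C(N, r), the probability that
r distinct points drawn among N avoid m given ones.  Passing from r to r + 1
multiplies p by 1 - m / (N - r), and
(N - m r) (N - m - r) - (N - r) (N - m r - m) = m r (m - 1) is nonnegative. *)
Lemma bin_sub_lower (N m r : nat) :
  ((N - m * r) * 'C(N, r) <= N * 'C(N - m, r))%N.
Proof.
elim: r => [|r IHr]; first by rewrite muln0 subn0 !bin0.
(* The factor r + 1 turns C(_, r + 1) into a multiple of C(_, r). *)
rewrite -(leq_pmul2l (ltn0Sn r)) [leqLHS]mulnCA [leqRHS]mulnCA !mul_bin_left.
have [le_N|lt_N] := leqP N (m * r.+1); first by rewrite (eqP le_N) mul0n.
apply: (@leq_trans ((N - m - r) * ((N - m * r) * 'C(N, r)))); last first.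
  by rewrite [leqRHS]mulnCA leq_mul2l IHr orbT.
rewrite !mulnA leq_mul2r; apply/orP; right.
have [->|m0] := posnP m; first by nia.
have : (m + r <= N)%N by nia.
by nia.
Qed.

(** This is p <= 1 / (1 + m r / N), with p as above.  In the inductive step,
(N - r) (N + m r) - (N - m - r) (N + m r + m) = m (r + m r + m) is
nonnegative. *)
Lemma bin_sub_upper (N m r : nat) :
  ((N + m * r) * 'C(N - m, r) <= N * 'C(N, r))%N.
Proof.
elim: r => [|r IHr]; first by rewrite muln0 addn0 !bin0.
rewrite -(leq_pmul2l (ltn0Sn r)) [leqLHS]mulnCA [leqRHS]mulnCA !mul_bin_left.
have [le_N|lt_N] := leqP (N - m) r; first by rewrite (eqP le_N) mul0n muln0.
apply: (@leq_trans ((N - r) * ((N + m * r) * 'C(N - m, r)))); last first.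
  by rewrite [leqRHS]mulnCA leq_mul2l IHr orbT.
rewrite !mulnA leq_mul2r; apply/orP; right.
have : (m + r < N)%N by lia.
by nia.
Qed.

(** * Random elements of a finite type *)

Section FiniteRandomElements.
Context (d : measure_display) (T : measurableType d) (R : realType).
Context (P : probability T R) (S : finType).

Lemma sum_pr_fibres (X : T -> S) (A : set T) :
  random_element X -> measurable A ->
  P A = (\sum_(s : S) P (X @^-1` [set s] `&` A))%E.
Proof.
move=> mX mA; rewrite (fsbig_seq _ _ (index_enum_uniq S)) -measure_fin_bigcup.
- congr (P _); apply/seteqP; split=> [w Aw|w [s _ []]//].
  by exists (X w) => //=; rewrite mem_index_enum.
- exact: finite_finset.
- by move=> s t _ _ [w [[/= <- _] [<-]]].
- by move=> s _; apply: measurableI => //; exact: mX.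
Qed.

(** The definition of [uniform_on] speaks of points only; summing over fibres
extends it to events. *)
Lemma uniform_on_pr (E B : {set S}) (X : T -> S) :
  random_element X -> uniform_on P E X ->
  P (X @^-1` [set` B]) = (#|E :&: B|%SET%:R / #|E|%:R)%:E.
Proof.
move=> mX uX; rewrite (sum_pr_fibres mX (mX _)).
have fibre s : P (X @^-1` [set s] `&` X @^-1` [set` B]) =
    (if s \in (E :&: B)%SET then (#|E|%:R)^-1 else 0)%:E.
  rewrite inE; have [sB|sB] := boolP (s \in B).
    rewrite andbT -uX; congr (P _).
    by apply/seteqP; split=> [w []|w /= ->].
  rewrite andbF -[RHS](measure0 P); congr (P _).
  by apply/seteqP; split=> [w [/= ->]|//]; rewrite (negPf sB).
under eq_bigr do rewrite fibre.
by rewrite sumEFin -big_mkcond sumr_const mulr_natl.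
Qed.

End FiniteRandomElements.

(** * Two independent uniform subsets *)

Lemma measurable_disjoint d (T : measurableType d) (S : finType)
    (F G : T -> {set S}) :
  random_element F -> random_element G ->
  measurable [set w | (F w :&: G w)%SET = finset.set0].
Proof.
move=> mF mG.
rewrite (_ : [set _ | _] = \bigcup_(A in [set: {set S}])
  (F @^-1` [set A] `&` G @^-1` [set B | (A :&: B)%SET = finset.set0])).
  apply: fin_bigcup_measurable; first exact: finite_finset.
  by move=> A _; apply: measurableI; [exact: mF|exact: mG].
by apply/seteqP; split=> [w /= FG0|w [A _ [/= ->]]//]; exists (F w).
Qed.

Lemma meet_setC (T : Type) (S : finType) (F G : T -> {set S}) :
  [set w | (F w :&: G w)%SET != finset.set0] =
  ~` [set w | (F w :&: G w)%SET = finset.set0].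
Proof. by apply/seteqP; split=> w /eqP. Qed.

Lemma card_draws_disjoint (S : finType) (U A : {set S}) (r : nat) :
  (A \subset U)%SET ->
  #|[set B : {set S} | (B \subset U) && (#|B| == r)] :&:
    [set B | A :&: B == finset.set0]|%SET = 'C(#|U| - #|A|, r).
Proof.
move=> AU; have -> : (#|U| - #|A|)%N = #|U :\: A|%SET.
  by rewrite cardsD (finset.setIidPr AU).
rewrite -cards_draws; apply: eq_card => B.
by rewrite !inE subsetD finset.setIC setI_eq0 andbAC.
Qed.

(** Condition on the value A of F: by independence, the event becomes that G is
disjoint from A, whose probability depends on A only through its size m. *)
Lemma pr_disjoint (d : measure_display) (T : measurableType d) (R : realType)
    (P : probability T R) (S : finType) (U : {set S}) (m r : nat)
    (F G : T -> {set S}) :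
  random_element F -> random_element G ->
  uniform_on P [set A : {set S} | (A \subset U) && (#|A| == m)]%SET F ->
  uniform_on P [set A : {set S} | (A \subset U) && (#|A| == r)]%SET G ->
  independent P F G -> (m <= #|U|)%N ->
  P [set w | (F w :&: G w)%SET = finset.set0] =
    ('C(#|U| - m, r)%:R / 'C(#|U|, r)%:R)%:E.
Proof.
move=> mF mG uF uG iFG mU.
rewrite (sum_pr_fibres P mF (measurable_disjoint mF mG)).
set E := [set A : {set S} | (A \subset U) && (#|A| == m)]%SET in uF.
pose q : R := 'C(#|U| - m, r)%:R / 'C(#|U|, r)%:R.
have fibre (A : {set S}) : P (F @^-1` [set A] `&`
      [set w | (F w :&: G w)%SET = finset.set0]) =
    (if A \in E then (#|E|%:R)^-1 * q else 0)%:E.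
  rewrite (_ : _ `&` _ = F @^-1` [set A] `&`
      G @^-1` [set` [set B | A :&: B == finset.set0]%SET]); last first.
    by apply/seteqP; split=> w [/= -> FG0]; split=> //=;
      move: FG0; rewrite inE => /eqP.
  rewrite iFG uF (uniform_on_pr _ mG uG) -EFinM.
  case: ifPn => [|_]; last by rewrite mul0r.
  rewrite inE => /andP[AU /eqP cA].
  by rewrite card_draws_disjoint// cA cards_draws.
under eq_bigr do rewrite fibre.
rewrite sumEFin -big_mkcond sumr_const -[_ *+ _]mulr_natl mulrA divff ?mul1r//.
by rewrite pnatr_eq0 -lt0n cards_draws bin_gt0.
Qed.

(** Both bounds are functions of m r / #|U|, the expected size of the
intersection, and hold for all sizes, so that they can be squeezed directly. *)
Lemma pr_meet_bounds (d : measure_display) (T : measurableType d)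
    (R : realType) (P : probability T R) (S : finType) (U : {set S})
    (m r : nat) (F G : T -> {set S}) :
  random_element F -> random_element G ->
  uniform_on P [set A : {set S} | (A \subset U) && (#|A| == m)]%SET F ->
  uniform_on P [set A : {set S} | (A \subset U) && (#|A| == r)]%SET G ->
  independent P F G -> (m <= #|U|)%N -> (r <= #|U|)%N -> (0 < #|U|)%N ->
  ((1 - (1 + (m * r)%:R / #|U|%:R)^-1)%:E
     <= P [set w | (F w :&: G w)%SET != finset.set0]
     <= ((m * r)%:R / #|U|%:R)%:E)%E.
Proof.
move=> mF mG uF uG iFG mU rU U0; set x : R := (m * r)%:R / _.
rewrite meet_setC probability_setC; last exact: measurable_disjoint.
rewrite (pr_disjoint mF mG uF uG iFG mU).
set N := #|U| in x mU rU U0 *.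
have N0 : 0 < N%:R :> R by rewrite ltr0n.
have C0 : 0 < 'C(N, r)%:R :> R by rewrite ltr0n bin_gt0.
have Nx : N%:R * x = (m * r)%:R :> R by rewrite mulrC divfK// gt_eqF.
have x0 : 0 <= x by rewrite divr_ge0// ler0n.
rewrite -EFinB !lee_fin; apply/andP; split.
  rewrite lerD2l lerN2 ler_pdivrMr// mulrC ler_pdivlMr; last by lra.
  rewrite -(ler_pM2l N0) mulrCA mulrDr mulr1 Nx -natrD -!natrM ler_nat mulnC.
  exact: bin_sub_upper.
rewrite lerBlDr -lerBlDl ler_pdivlMr// -(ler_pM2l N0) mulrA mulrBr mulr1 Nx.
have := bin_sub_lower N m r; rewrite -(ler_nat R) !natrM.
apply: le_trans; rewrite ler_wpM2r ?ler0n// lerBlDr -natrM -natrD ler_nat.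
by rewrite addnC -leq_subLR.
Qed.

(** * The threshold for a common circuit *)

Theorem theorem7p2 (R : realType) (k : nat) (hk : (1 <= k)%N)
  (r : nat -> nat)
  (hr : forall n : nat, (k.+1 <= n)%N -> (r n <= 'C(n, k.+1))%N)
  (d : nat -> measure_display)
  (T : forall n : nat, measurableType (d n))
  (P : forall n : nat, probability (T n) R)
  (F G : forall n : nat, T n -> {set {set 'I_n}})
  (hF : forall n : nat, (k.+1 <= n)%N ->
    random_element (F n) /\ uniform_on (P n) (circuit_sets n k (r n)) (F n))
  (hG : forall n : nat, (k.+1 <= n)%N ->
    random_element (G n) /\ uniform_on (P n) (circuit_sets n k (r n)) (G n))
  (hFG : forall n : nat, (k.+1 <= n)%N -> independent (P n) (F n) (G n)) :
  (((r n)%:R : R) / Num.sqrt ('C(n, k.+1)%:R : R) @[n --> \oo] --> (0 : R) ->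
    P n [set w : T n | (F n w :&: G n w)%SET != finset.set0] @[n --> \oo]
      --> 0%:E) /\
  (((r n)%:R : R) / Num.sqrt ('C(n, k.+1)%:R : R) @[n --> \oo] --> +oo ->
    P n [set w : T n | (F n w :&: G n w)%SET != finset.set0] @[n --> \oo]
      --> 1%:E).
Proof.
pose x n : R := (r n * r n)%:R / 'C(n, k.+1)%:R.
have bounds : \forall n \near \oo,
    ((1 - (1 + x n)^-1)%:E
      <= P n [set w : T n | (F n w :&: G n w)%SET != finset.set0]
      <= (x n)%:E)%E.
  near=> n.
  have kn : (k.+1 <= n)%N by near: n; exact: nbhs_infty_ge.
  have [mF uF] := hF n kn; have [mG uG] := hG n kn.
  have cU : #|circuits n k| = 'C(n, k.+1).
    by rewrite card_draws card_ord.
  rewrite /x -cU; apply: pr_meet_bounds => //; first exact: hFG.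
  - by rewrite cU hr.
  - by rewrite cU hr.
  - by rewrite cU bin_gt0.
have sqrE n : ((r n)%:R / Num.sqrt 'C(n, k.+1)%:R) ^+ 2 = x n.
  by rewrite expr_div_n sqr_sqrtr ?ler0n// /x natrM expr2.
split=> [small|large].
  have x_to0 : x n @[n --> \oo] --> (0 : R).
    rewrite -(mulr0 0); under eq_fun do rewrite -sqrE expr2.
    exact: cvgM.
  apply: (squeeze_cvge bounds); apply: cvg_EFin => //; try exact: nearW.
  rewrite -[X in _ --> X](subrr 1); apply: cvgB; first exact: cvg_cst.
  rewrite [X in _ --> X](_ : _ = (1 + 0)^-1); last by rewrite addr0 invr1.
  apply: cvgV; first by rewrite addr0 oner_eq0.
  by apply: cvgD => //; exact: cvg_cst.
have inv_to0 : (1 + x n)^-1 @[n --> \oo] --> (0 : R).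
  apply/gtr0_cvgV0.
    by apply: nearW => n; rewrite ltr_pwDl// divr_ge0// ler0n.
  apply/cvgryPge => A.
  have large_n := proj1 (cvgryPge _) large (Num.max A 1).
  (* Once y = r / sqrt N is at least A and 1, so is 1 + y ^+ 2. *)
  near=> n; rewrite -sqrE.
  have : Num.max A 1 <= (r n)%:R / Num.sqrt 'C(n, k.+1)%:R.
    by near: n; exact: large_n.
  rewrite ge_max => /andP[]; nra.
apply: (squeeze_cvge (f := fun n => (1 - (1 + x n)^-1)%:E) (h := cst 1%E)); last exact: cvg_cst.
  near=> n; apply/andP; split.
    by near: n; apply: (filterS _ bounds) => n /andP[].
  have kn : (k.+1 <= n)%N by near: n; exact: nbhs_infty_ge.
  have [mF _] := hF n kn; have [mG _] := hG n kn.
  apply: probability_le1.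
  by rewrite meet_setC; apply: measurableC; exact: measurable_disjoint.
apply: cvg_EFin; first exact: nearW.
rewrite -[X in _ --> X](subr0 1); apply: cvgB => //; exact: cvg_cst.
Unshelve. all: by end_near.
Qed.
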